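(* Let $G=\mathbb{R}_{>0}$ (multiplicative group), $H=\{1\}$, $V=\mathbb{R}^2$, and let $\rho:G\to GL(V)$ be the representation $\rho(g)=\begin{pmatrix} g&0\\0&g^{-1}\end{pmatrix}$. Then the pairs $\left(V,\begin{pmatrix} r\\ s\end{pmatrix}\right)$ with $r,s\in\mathbb{R}$, $r\neq0$ and $s\neq0$, are all equivalent to each other. Moreover, for every such $r,s$, the family of probability measures on $X=G/H=\mathbb{R}_{>0}$ generated from $\left(V,\begin{pmatrix} r\\ s\end{pmatrix}\right)$ (as defined in the context) is the family $\{p_{a,b,\lambda}\}_{(a,b,\lambda)\in\Theta}$ of generalized inverse Gaussian distributions $$dp_{a,b,\lambda}(x)=c_{a,b,\lambda}\,x^{\lambda-1}e^{-(ax+b/x)/2}\,dx\qquad(x\in\mathbb{R}_{>0}),$$ where $dx$ is Lebesgue measure on $\mathbb{R}_{>0}$, $c_{a,b,\lambda}$ is the normalizing constant, and $\Theta$ is the set of $(a,b,\lambda)\in\mathbb{R}^3$ satisfying one of: (i) $a>0,\ b>0$; (ii) $a>0,\ b=0,\ \lambda>0$; (iii) $a=0,\ b>0,\ \lambda<0$.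
   Context: The normalizing constants are, in the respective cases, (i) $c_{a,b,\lambda}=\frac{(a/b)^{\lambda/2}}{2K_\lambda(\sqrt{ab})}$, (ii) $c_{a,b,\lambda}=\frac{1}{\Gamma(\lambda)}\left(\frac a2\right)^{\lambda}$, (iii) $c_{a,b,\lambda}=\frac{1}{\Gamma(-\lambda)}\left(\frac b2\right)^{-\lambda}$, where $K_\lambda$ is the modified Bessel function of the second kind with index $\lambda$. For a Lie group $G$, write $gv:=\rho(g)v$ for a representation $(\rho,V)$. A vector $v\in V$ is cyclic if $\operatorname{span}\{gv:g\in G\}=V$. Pairs $(V,v_0),(V',v_0')$, each consisting of a finite dimensional real representation and a cyclic vector in it, are equivalent, $(V,v_0)\sim(V',v_0')$, if there is a $G$-equivariant linear isomorphism $\psi:V\to V'$ with $\psi(v_0)=v_0'$. Family generated from a pair: let $H\subset G$ be a closed subgroup, $X=G/H$, $v_0\in V$ an $H$-fixed vector, $\mu$ a relatively $G$-invariant measure on $X$ (a nonzero Radon measure such that each $g\in G$ translates $\mu$ to $c(g)\mu$ with $c:G\to\mathbb{R}_{>0}$ a continuous homomorphism; for $G=\mathbb{R}_{>0}$, $H=\{1\}$ one takes $d\mu(x)=dx/x$). Let $\Omega_0(G,H)$ be the set of continuous group homomorphisms $\chi:G\to\mathbb{R}_{>0}$ with $\chi|_H=1$. For $\theta=(\xi,\chi)\in V^\vee\times\Omega_0(G,H)$ put $d\tilde p_\theta(x):=\exp(-\langle\xi,xv_0\rangle)\chi(x)d\mu(x)$ (where $xv_0:=gv_0$, $\chi(x):=\chi(g)$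 for $x=gH$). The family generated is the set of probability measures $p_\theta:=\tilde p_\theta/\tilde p_\theta(X)$, with $\theta$ ranging over all elements of $V^\vee\times\Omega_0(G,H)$ such that $\int_X d\tilde p_\theta<\infty$. *)

(* Defs.v *)
From HB Require Import structures.
From mathcomp Require Import all_boot all_order all_algebra.
From mathcomp Require Import all_classical all_reals all_analysis.
From mathcomp Require Import measurable_realfun.

Set Implicit Arguments.
Unset Strict Implicit.
Unset Printing Implicit Defensive.

Import Order.TTheory GRing.Theory Num.Theory.
Import numFieldNormedType.Exports.

Local Open Scope classical_set_scope.
Local Open Scope ring_scope.

(* Only the topological group structure of a Lie group enters the notions
   below: representations and characters are required to be continuous. *)
HB.mixin Record isTopologicalGroup G & Topological G & Group G := {
  mulg_continuous : continuous (fun x : G * G => (x.1 * x.2)%g);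
  invg_continuous : continuous (fun x : G => (x^-1)%g)
}.

#[short(type="topologicalGroupType")]
HB.structure Definition TopologicalGroup :=
  {G of Topological G & Group G & isTopologicalGroup G}.

Record Rpos (R : realType) := MkRpos {
  rpos_val :> R;
  rpos_gt0 : 0 < rpos_val
}.

Section Rpos_structures.
Context {R : realType}.
Implicit Types x y z : Rpos R.

HB.instance Definition _ := [isSub for @rpos_val R].
HB.instance Definition _ := [Choice of Rpos R by <:].

Definition rpos_one : Rpos R := MkRpos ltr01.

Definition rpos_mul x y : Rpos R :=
  MkRpos (mulr_gt0 (rpos_gt0 x) (rpos_gt0 y)).

Lemma rpos_inv_gt0 x : 0 < (x : R)^-1.
Proof. by rewrite invr_gt0 rpos_gt0. Qed.

Definition rpos_inv x : Rpos R := MkRpos (rpos_inv_gt0 x).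

Lemma rpos_mulA : associative rpos_mul.
Proof. by move=> x y z; apply: val_inj; rewrite /= mulrA. Qed.

Lemma rpos_mul1 : left_id rpos_one rpos_mul.
Proof. by move=> x; apply: val_inj; rewrite /= mul1r. Qed.

Lemma rpos_mulr1 : right_id rpos_one rpos_mul.
Proof. by move=> x; apply: val_inj; rewrite /= mulr1. Qed.

Lemma rpos_mulV : left_inverse rpos_one rpos_inv rpos_mul.
Proof.
by move=> x; apply: val_inj; rewrite /= mulVf// gt_eqF// rpos_gt0.
Qed.

Lemma rpos_mulrV : right_inverse rpos_one rpos_inv rpos_mul.
Proof.
by move=> x; apply: val_inj; rewrite /= mulfV// gt_eqF// rpos_gt0.
Qed.

HB.instance Definition _ := isGroup.Build (Rpos R)
  rpos_mulA rpos_mul1 rpos_mulr1 rpos_mulV rpos_mulrV.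

HB.instance Definition _ := isPointed.Build (Rpos R) rpos_one.

HB.instance Definition _ := Topological.copy (Rpos R)
  (initial_topology (@rpos_val R)).

Lemma rpos_val_continuous : continuous (@rpos_val R).
Proof. exact: initial_continuous. Qed.

Lemma rpos_mul_continuous :
  continuous (fun x : Rpos R * Rpos R => (x.1 * x.2)%g).
Proof.
apply: (@continuous_comp_initial _ _ _ (@rpos_val R)).
move=> [x y]; apply: (@continuousM R (Rpos R * Rpos R)%type
    (fun u => rpos_val u.1) (fun u => rpos_val u.2)).
- apply: (@continuous_comp _ _ _ fst (@rpos_val R)); first exact: cvg_fst.
  exact: rpos_val_continuous.
- apply: (@continuous_comp _ _ _ snd (@rpos_val R)); first exact: cvg_snd.
  exact: rpos_val_continuous.
Qed.

Lemma rpos_inv_continuous : continuous (fun x : Rpos R => (x^-1)%g).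
Proof.
apply: (@continuous_comp_initial _ _ _ (@rpos_val R)).
move=> x; apply: (@continuous_comp _ _ _ (@rpos_val R) GRing.inv).
  exact: rpos_val_continuous.
by apply: inv_continuous; rewrite gt_eqF// rpos_gt0.
Qed.

HB.instance Definition _ := isTopologicalGroup.Build (Rpos R)
  rpos_mul_continuous rpos_inv_continuous.

(* The trace on R_{>0} of the Borel sigma-algebra of R. *)
HB.instance Definition _ := Measurable.copy (Rpos R)
  (g_sigma_algebra_preimageType (@rpos_val R)).

End Rpos_structures.

Lemma measurable_rpos_val (R : realType) :
  measurable_fun [set: Rpos R] (@rpos_val R).
Proof. by move=> _ B mB; exists B. Qed.

Lemma measurable_rpos_image (R : realType) (A : set (Rpos R)) :
  measurable A -> measurable (@rpos_val R @` A).
Proof.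
move=> [B mB <-]; rewrite setTI.
have -> : @rpos_val R @` (@rpos_val R @^-1` B) = B `&` `]0, +oo[.
  apply/seteqP; split=> [_ [x Bx <-]|x [Bx]] /=.
    by split=> //; rewrite in_itv/= andbT rpos_gt0.
  by rewrite in_itv/= andbT => x0; exists (MkRpos x0).
exact: measurableI.
Qed.

Section Rpos_measures.
Context {R : realType}.
Local Open Scope ereal_scope.

Definition Rpos_lebesgue (A : set (Rpos R)) : \bar R :=
  lebesgue_measure (@rpos_val R @` A).

Let Rpos_lebesgue0 : Rpos_lebesgue set0 = 0.
Proof. by rewrite /Rpos_lebesgue image_set0 measure0. Qed.

Let Rpos_lebesgue_ge0 A : 0 <= Rpos_lebesgue A.
Proof. exact: measure_ge0. Qed.

Let Rpos_lebesgue_sigma_additive : semi_sigma_additive Rpos_lebesgue.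
Proof.
move=> F mF tF mUF; rewrite /Rpos_lebesgue image_bigcup.
apply: measure_semi_sigma_additive.
- by move=> i; exact: measurable_rpos_image.
- move=> i j _ _ [_ [[x Fx <-] [y Fy /val_inj yx]]].
  by apply: tF => //; exists x; split => //; rewrite -yx.
- by rewrite -image_bigcup; exact: measurable_rpos_image.
Qed.

HB.instance Definition _ := isMeasure.Build _ (Rpos R) R Rpos_lebesgue
  Rpos_lebesgue0 Rpos_lebesgue_ge0 Rpos_lebesgue_sigma_additive.

(* dx / x *)
Definition Rpos_haar (A : set (Rpos R)) : \bar R :=
  \int[Rpos_lebesgue]_(x in A) ((x : R)^-1)%:E.

Let Rpos_haar0 : Rpos_haar set0 = 0.
Proof. by rewrite /Rpos_haar integral_set0. Qed.

Let Rpos_haar_ge0 A : 0 <= Rpos_haar A.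
Proof.
by apply: integral_ge0 => x _; rewrite lee_fin invr_ge0 ltW// rpos_gt0.
Qed.

Let Rpos_haar_sigma_additive : semi_sigma_additive Rpos_haar.
Proof.
apply: semi_sigma_additive_nng_induced => [|x]; last first.
  by rewrite lee_fin invr_ge0 ltW// rpos_gt0.
apply/measurable_EFinP.
have -> : (fun x : Rpos R => (x : R)^-1)%R =
    (fun y : R => y `^ (-1))%R \o @rpos_val R.
  by apply/funext => x /=; rewrite powR_inv1// ltW// rpos_gt0.
apply: measurableT_comp; last exact: measurable_rpos_val.
exact: measurable_powR.
Qed.

HB.instance Definition _ := isMeasure.Build _ (Rpos R) R Rpos_haar
  Rpos_haar0 Rpos_haar_ge0 Rpos_haar_sigma_additive.

End Rpos_measures.

Section pairs.
Context {R : realType} {G : topologicalGroupType}.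

(* A representation on R^n, in matrix form. *)
Definition representation n (rho : G -> 'M[R]_n) : Prop :=
  [/\ rho 1%g = 1%:M,
      (forall g h, rho (g * h)%g = rho g *m rho h) &
      continuous rho].

Definition cyclic_vector n (rho : G -> 'M[R]_n) (v : 'cV[R]_n) : Prop :=
  forall w : 'cV[R]_n, exists (k : nat) (c : 'I_k -> R) (g : 'I_k -> G),
    w = \sum_(i < k) c i *: (rho (g i) *m v).

Definition cyclic_pair n (rho : G -> 'M[R]_n) (v : 'cV[R]_n) : Prop :=
  representation rho /\ cyclic_vector rho v.

Definition equivalent_pairs n (rho : G -> 'M[R]_n) (v : 'cV[R]_n)
    n' (rho' : G -> 'M[R]_n') (v' : 'cV[R]_n') : Prop :=
  exists psi : {linear 'cV[R]_n -> 'cV[R]_n'},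
    [/\ bijective psi,
        (forall g w, psi (rho g *m w) = rho' g *m psi w) &
        psi v = v'].

Definition Omega0 (H : set G) (chi : G -> Rpos R) : Prop :=
  [/\ continuous chi,
      {morph chi : g h / (g * h)%g} &
      forall h, H h -> chi h = 1%g].

(* X stands for G/H, with projection pi, and mu for a relatively G-invariant
   measure on it. The function f is x |-> exp(- <xi, x v0>) chi(x), which
   descends to X when v0 is H-fixed. A measure is determined by its values on measurable sets only: the library
   leaves it unspecified elsewhere, so the set below collects every
   representative of each p_theta. *)
Definition generated_family (H : set G) d (X : measurableType d) (pi : G -> X)
    (mu : {measure set X -> \bar R}) n (rho : G -> 'M[R]_n) (v0 : 'cV[R]_n) :
    set (probability X R) :=
  [set P : probability X R | exists (xi : {scalar 'cV[R]_n}) (chi : G -> Rpos R) (f : X -> R),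
    [/\ Omega0 H chi,
        (forall g, f (pi g) = expR (- xi (rho g *m v0)) * (chi g : R)),
        (\int[mu]_x (f x)%:E < +oo)%E &
        forall A, measurable A ->
          P A = (\int[mu]_(x in A) (f x)%:E / \int[mu]_x (f x)%:E)%E]].

End pairs.

Section gig.
Context {R : realType}.
Implicit Types a b l : R.

Definition Gamma (s : R) : R :=
  (\int[lebesgue_measure]_(t in `]0%R, +oo[) (t `^ (s - 1) * expR (- t)))%R.

(* Modified Bessel function of the second kind, for z > 0, by its integral
   representation  int_0^oo exp(- z cosh t) cosh(l t) dt. *)
Definition besselK l (z : R) : R :=
  let cosh t := (expR t + expR (- t)) / 2 in
  (\int[lebesgue_measure]_(t in `[0%R, +oo[)
    (expR (- (z * cosh t)) * cosh (l * t)))%R.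

Definition gig_parameter a b l : Prop :=
  [\/ 0 < a /\ 0 < b,
      [/\ 0 < a, b = 0 & 0 < l] |
      [/\ a = 0, 0 < b & l < 0]].

(* Only used under gig_parameter. *)
Definition gig_constant a b l : R :=
  if b == 0 then (Gamma l)^-1 * (a / 2) `^ l
  else if a == 0 then (Gamma (- l))^-1 * (b / 2) `^ (- l)
  else (a / b) `^ (l / 2) / (2 * besselK l (Num.sqrt (a * b))).

Definition gig_density a b l (x : Rpos R) : R :=
  let t : R := x in
  gig_constant a b l * t `^ (l - 1) * expR (- (a * t + b / t) / 2).

(* As in generated_family, P ranges over all representatives of p_{a,b,l}. *)
Definition gig_family : set (probability (Rpos R) R) :=
  [set P : probability (Rpos R) R | exists a b l, gig_parameter a b l /\
    forall A, measurable A ->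
      P A = (\int[Rpos_lebesgue]_(x in A) (gig_density a b l x)%:E)%E].

Definition gig_rep (g : Rpos R) : 'M[R]_2 :=
  \matrix_(i, j) if i == j then (if i == 0 then (g : R) else (g : R)^-1) else 0.

Definition cvec2 (r s : R) : 'cV[R]_2 :=
  \col_i if i == 0 then r else s.

End gig.

(* Main.v *)
From HB Require Import structures.
Require Import Defs.
From mathcomp Require Import all_boot all_order all_algebra.
From mathcomp Require Import all_classical all_reals all_analysis.
From mathcomp Require Import measurable_realfun ring lra.

Set Implicit Arguments.
Unset Strict Implicit.
Unset Printing Implicit Defensive.

Import Order.TTheory GRing.Theory Num.Theory.
Import numFieldNormedType.Exports.

Local Open Scope classical_set_scope.
Local Open Scope ring_scope.

(** The representation is diagonal with the two distinct characters [g] and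
    [g^-1], so a vector with two nonzero coordinates is cyclic, and an
    invertible diagonal matrix, which commutes with the representation, carries
    any such vector to any other.

    For the family, the coordinates of [xi] give
    [<xi, g v0> = (a g + b / g) / 2] with [a] and [b] arbitrary real numbers
    ([scalar_gig_rep], [scalar_coords]), because neither coordinate of [v0]
    vanishes.  A continuous character of the positive reals is a power
    [x ^ l]: in the variable [t = ln x] it becomes a continuous additive map
    ([Omega0_powR]).  Hence the densities [exp (- <xi, x v0>) chi(x)] against
    [dx / x] are the functions [gig_weight a b l], and it remains to find which
    of them have finite mass and to compute that mass.

    Put [x = exp t].  The mass becomes
    [log_mass a b l = int_R exp (l t - (a e^t + b e^-t) / 2) dt], on which
    inversion [x -> 1 / x] acts as the reflection [t -> - t] and dilation as a
    translation.  Cut the line at [0]: by reflection both halves are values of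
    [half_mass], and on [t >= 0] the term [b e^-t] is bounded, so
    [half_mass a b l] is finite exactly when [a > 0], or [a = 0] and [l < 0]
    ([half_mass_lty]).  Imposing this on both halves gives the parameter set
    ([log_mass_lty]).  A translation brings [(a, 0)] to [(2, 0)], where the
    integral is [Gamma l], and brings [(a, b)] to [(z, z)] with
    [z = sqrt (a b)], where folding the line at [0] gives [2 K_l(z)]; this
    yields the normalizing constants ([gig_constant_mass]). *)

(** * The exponential change of variable *)

Section expsubst.
Context {R : realType}.
Local Notation mu := (@lebesgue_measure R).
(** The substitution rules for a half-line ask the derivative to converge at
    infinity, which [exp] violates; so substitute on the segments [[- n, n]] and
    pass to the limit by monotone convergence. *)
Lemma ge0_integral_expR_subst (g : R -> R) :
  {in `]0, +oo[, continuous g} -> {in `]0, +oo[, forall x, 0 <= g x} ->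
  (\int[mu]_(x in `]0%R, +oo[) (g x)%:E =
   \int[mu]_t (g (expR t) * expR t)%:E)%E.
Proof.
move=> cg g0.
have derE : derive1 (@expR R) = expR.
  by apply/funext => t; rewrite derive1E derive_val.
have cge : continuous (fun t => g (expR t) * expR t).
  move=> t; apply: cvgM; last exact: continuous_expR.
  apply: continuous_comp; first exact: continuous_expR.
  by apply: cg; rewrite in_itv/= andbT expR_gt0.
pose I n : set R := `[expR (- n%:R), expR n%:R]%classic.
pose J n : set R := `[- n%:R, n%:R]%classic.
have IE : \bigcup_n I n = `]0, +oo[%classic.
  apply/seteqP; split=> [x [n _]|x]; rewrite /I /= !in_itv/= ?andbT.
    by move=> /andP[+ _]; apply: lt_le_trans; exact: expR_gt0.
  move=> x0; have [n nx] : exists n : nat, `|ln x| <= n%:R.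
    exists (Num.truncn `|ln x|).+1; exact/ltW/truncnS_gt.
  exists n => //; rewrite /I /= in_itv/=.
  move: nx; rewrite ler_norml => /andP[nx xn].
  by rewrite -(lnK x0) !ler_expR nx xn.
have IS n : I n `<=` `]0, +oo[%classic by rewrite -IE; exact: bigcup_sup.
have JE : \bigcup_n J n = setT.
  apply/seteqP; split=> // x _.
  exists (Num.truncn `|x|).+1 => //.
  by rewrite /J /= in_itv/= -ler_norml; exact/ltW/truncnS_gt.
have IJ n : (\int[mu]_(x in I n) (g x)%:E =
             \int[mu]_(t in J n) (g (expR t) * expR t)%:E)%E.
  rewrite /I integration_by_substitution_increasing.
  - by rewrite derE.
  - by rewrite -subr_ge0 opprK addr_ge0.
  - by move=> x y _ _; rewrite ltr_expR.
  - by rewrite derE => x _; exact: continuous_expR.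
  - rewrite derE; apply: cvgP; apply: cvg_at_right_filter.
    exact: continuous_expR.
  - rewrite derE; apply: cvgP; apply: cvg_at_left_filter.
    exact: continuous_expR.
  - split=> [x _||]; first exact: derivable_expR.
    + by apply: cvg_at_right_filter; exact: continuous_expR.
    + by apply: cvg_at_left_filter; exact: continuous_expR.
  - apply: continuous_in_subspaceT => x; rewrite inE/= in_itv/= => /andP[xn _].
    by apply: cg; rewrite in_itv/= andbT; apply: lt_le_trans xn; exact: expR_gt0.
have mg : measurable_fun (`]0, +oo[%classic : set R) (EFin \o g).
  apply/measurable_EFinP; apply: open_continuous_measurable_fun => //.
  by move=> x; rewrite inE/=; exact: cg.
rewrite -[X in (integral mu X _ = _)%E]IE -[X in (_ = integral mu X _)%E]JE.
have : (\int[mu]_(x in I n) (g x)%:E @[n --> \oo] -->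
        \int[mu]_(x in \bigcup_n I n) (g x)%:E)%E.
  apply: ge0_nondecreasing_set_cvg_integral.
  - apply/nondecreasing_seqP => n; rewrite subsetEset /I => x /=.
    rewrite !in_itv/= => /andP[nx xn]; apply/andP; split.
      by apply: le_trans nx; rewrite ler_expR lerN2 ler_nat.
    by apply: (le_trans xn); rewrite ler_expR ler_nat.
  - by move=> n; exact: measurable_itv.
  - by move=> n; apply: measurable_funS mg.
  - by move=> n x /IS /g0; rewrite lee_fin.
have : (\int[mu]_(x in J n) (g (expR x) * expR x)%:E @[n --> \oo] -->
        \int[mu]_(x in \bigcup_n J n) (g (expR x) * expR x)%:E)%E.
  apply: ge0_nondecreasing_set_cvg_integral.
  - apply/nondecreasing_seqP => n; rewrite subsetEset /J => x /=.
    rewrite !in_itv/= => /andP[nx xn]; apply/andP; split.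
      by apply: le_trans nx; rewrite lerN2 ler_nat.
    by apply: (le_trans xn); rewrite ler_nat.
  - by move=> n; exact: measurable_itv.
  - move=> n; apply/measurable_EFinP/measurable_funTS; exact: continuous_measurable_fun.
  - move=> n x _; rewrite lee_fin mulr_ge0 ?expR_ge0// g0//.
    by rewrite in_itv/= andbT expR_gt0.
under eq_fun do rewrite -IJ.
by move=> c1 c2; apply: cvg_unique c2 c1; exact: ereal_hausdorff.
Qed.
End expsubst.

(** * The mass in logarithmic coordinates *)

Section logmass.
Context {R : realType}.
Local Notation mu := (@lebesgue_measure R).
Implicit Types a b l t : R.

(** The density in the variable [t = ln x]: the Jacobian [dx = e^t dt] is
    included, which turns the exponent [l - 1] of [x] into [l]. *)
Definition log_density a b l t : R :=
  expR (l * t - (a * expR t + b * expR (- t)) / 2).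

Definition log_mass a b l : \bar R := (\int[mu]_t (log_density a b l t)%:E)%E.

(** The half-line is enough to describe [log_mass]: [log_mass_split] expresses the
    part over negative [t] by reflection. *)
Definition half_mass a b l : \bar R :=
  (\int[mu]_(t in `[0%R, +oo[) (log_density a b l t)%:E)%E.

Lemma log_density_ge0 a b l t : 0 <= log_density a b l t.
Proof. exact: expR_ge0. Qed.

Lemma continuous_log_density a b l : continuous (log_density a b l).
Proof.
move=> t; apply: continuous_comp; last exact: continuous_expR.
apply: cvgB; first by apply: cvgM; [exact: cvg_cst|exact: cvg_id].
apply: cvgM; last exact: cvg_cst.
apply: cvgD; apply: cvgM; try exact: cvg_cst; first exact: continuous_expR.
by apply: continuous_comp; [exact: cvgN|exact: continuous_expR].
Qed.

Lemma measurable_log_density a b l (D : set R) :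
  measurable_fun D (fun t => (log_density a b l t)%:E).
Proof.
apply/measurable_EFinP/measurable_funTS; apply: continuous_measurable_fun.
exact: continuous_log_density.
Qed.

Lemma log_densityN a b l t : log_density a b l (- t) = log_density b a (- l) t.
Proof. by rewrite /log_density opprK; congr expR; ring. Qed.

Lemma log_mass_split a b l :
  log_mass a b l = (half_mass a b l + half_mass b a (- l))%E.
Proof.
rewrite /log_mass -(setUv (`[0%R, +oo[%classic : set R)) ge0_integral_setU//=;
  last 4 first.
- exact: measurableC.
- exact: measurable_log_density.
- by move=> t _; rewrite lee_fin log_density_ge0.
- exact/disj_setPCl.
congr (_ + _)%E; rewrite setCitvr.
rewrite integral_itv_bndo_bndc; last exact: measurable_log_density.
rewrite -{1}oppr0 ge0_integration_by_substitutionNy.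
- by apply: eq_integral => t _; rewrite /= log_densityN.
- by apply: continuous_subspaceT; exact: continuous_log_density.
- by move=> t _; exact: log_density_ge0.
Qed.

(** Translating [t] by [c] is the dilation of [x] by [e^c]; it multiplies [a],
    divides [b], and extracts the value of the character at [e^c]. *)
Lemma log_mass_translate a b l c :
  log_mass a b l =
  ((expR (l * c))%:E * log_mass (a * expR c) (b * expR (- c)) l)%E.
Proof.
rewrite /log_mass -ge0_integralZl//=; first last.
- by move=> t _; rewrite lee_fin log_density_ge0.
- exact: measurable_log_density.
have dF : derive1 (fun t : R => t + c) = cst 1.
  apply/funext => t; rewrite derive1E derive_val; by rewrite addr0.
rewrite (@increasing_ge0_integration_by_substitutionT _ (fun t => t + c)).
- rewrite dF; apply: eq_integral => t _.
  rewrite -EFinM; congr EFin; rewrite fctE /= mulr1 /log_density -expRD opprD.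
  rewrite !(expRD _ c) !(expRD _ (- c)).
  by congr expR; ring.
- by move=> x y xy; rewrite ltrD2r.
- by rewrite dF => t; exact: cvg_cst.
- by rewrite dF; exact: is_cvg_cst.
- by rewrite dF; exact: is_cvg_cst.
- by move=> t; exact: derivableD.
- apply/cvgrNyPle => A; near=> t.
  by rewrite -lerBrDr; near: t; by apply: nbhs_ninfty_le; exact: num_real.
- apply/cvgryPge => A; near=> t.
  by rewrite -lerBlDr; near: t; by apply: nbhs_pinfty_ge; exact: num_real.
- exact: continuous_log_density.
- exact: log_density_ge0.
Unshelve. all: by end_near. Qed.

(** A density bounded below by a positive constant near infinity has infinite
    integral. *)
Lemma half_mass_eqy a b l (M K : R) : 0 <= M ->
  (forall t, M <= t -> K <= l * t - (a * expR t + b * expR (- t)) / 2) ->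
  half_mass a b l = +oo%E.
Proof.
move=> M0 MK; apply/eqP; rewrite -leye_eq.
have <- : (\int[mu]_(t in `[M, +oo[) (expR K)%:E = +oo)%E.
  rewrite integral_cst//= lebesgue_measure_itv/= ltry/=.
  by rewrite addye// gt0_muley// lte_fin expR_gt0.
apply: (@le_trans _ _
    (\int[mu]_(t in `[M, +oo[) (log_density a b l t)%:E)%E).
  apply: ge0_le_integral => //.
  - exact: measurable_log_density.
  - move=> t; rewrite /= in_itv/= andbT => Mt.
    by rewrite lee_fin ler_expR MK.
apply: ge0_subset_integral => //.
- exact: measurable_log_density.
- by move=> t _; rewrite lee_fin log_density_ge0.
- by move=> t /=; rewrite !in_itv/= !andbT; exact: le_trans.
Qed.

(** Domination by a multiple of an exponential probability density. *)
Lemma half_mass_bounded_lty a b l (e K : R) : 0 < e ->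
  (forall t, 0 <= t -> l * t - (a * expR t + b * expR (- t)) / 2 <= K - e * t) ->
  (half_mass a b l < +oo)%E.
Proof.
move=> e0 eK.
(* the factor [e^-1] undoes the normalization of the exponential density *)
have intE : (\int[mu]_(t in `[0%R, +oo[)
    (expR K * e^-1 * exponential_pdf e t)%:E < +oo)%E.
  under eq_integral do rewrite EFinM.
  rewrite ge0_integralZl//=.
  - rewrite lte_mul_pinfty ?lee_fin ?mulr_ge0 ?expR_ge0 ?invr_ge0 ?(ltW e0)//.
    apply: (@le_lt_trans _ _ (\int[mu]_t (exponential_pdf e t)%:E)%E).
      apply: ge0_subset_integral => //.
      - by apply/measurable_EFinP; exact: measurable_exponential_pdf.
      - by move=> t _; rewrite lee_fin exponential_pdf_ge0// ltW.
    by rewrite integral_exponential_pdf// ltry.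
  - by apply/measurable_EFinP/measurable_funTS; exact: measurable_exponential_pdf.
  - by move=> t _; rewrite lee_fin exponential_pdf_ge0// ltW.
  - by rewrite lee_fin mulr_ge0 ?expR_ge0 ?invr_ge0 ?(ltW e0).
apply: le_lt_trans intE; apply: ge0_le_integral => //.
- by move=> t _; rewrite lee_fin log_density_ge0.
- exact: measurable_log_density.
- apply/measurable_EFinP/measurable_funTS.
  by apply: measurable_funM => //; exact: measurable_exponential_pdf.
- move=> t; rewrite /= in_itv/= andbT => t0.
  rewrite lee_fin exponential_pdfE// -mulrA mulKf ?gt_eqF// -expRD ler_expR.
  by rewrite mulNr eK.
Qed.

Lemma half_mass_gt0 a b l : (0 < half_mass a b l)%E.
Proof.
(* a lower bound of the exponent on [[0, 1]] *)
pose K := - (`|l| + (`|a| * expR 1 + `|b|) / 2).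
apply: (@lt_le_trans _ _ (\int[mu]_(t in `[0%R, 1%R]) (expR K)%:E)%E).
  rewrite integral_cst//= lebesgue_measure_itv/= lte_fin ltr01 oppr0 adde0.
  by rewrite mule1 lte_fin expR_gt0.
apply: (@le_trans _ _
    (\int[mu]_(t in `[0%R, 1%R]) (log_density a b l t)%:E)%E).
  apply: ge0_le_integral => //.
  - exact: measurable_log_density.
  - move=> t; rewrite /= in_itv/= => /andP[t0 t1].
    rewrite lee_fin ler_expR /K lerNl opprB addrC.
    have e1 : expR t <= expR 1 by rewrite ler_expR.
    have e2 : expR (- t) <= 1 by rewrite expR_le1 oppr_le0.
    have e3 := expR_gt0 t; have e4 := expR_gt0 (- t).
    have h1 : a * expR t <= `|a| * expR 1.
      by apply: (le_trans (ler_norm _)); rewrite normrM (gtr0_norm e3) ler_wpM2l.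
    have h2 : b * expR (- t) <= `|b|.
      by apply: (le_trans (ler_norm _)); rewrite normrM (gtr0_norm e4) ler_piMr.
    have h3 : - (l * t) <= `|l|.
      rewrite -mulNr; apply: (le_trans (ler_norm _)).
      by rewrite normrM normrN (ger0_norm t0) ler_piMr.
    by lra.
apply: ge0_subset_integral => //.
- exact: measurable_log_density.
- by move=> t _; rewrite lee_fin log_density_ge0.
- by move=> t /=; rewrite !in_itv/= andbT => /andP[].
Qed.

Lemma expR_ge_sqr (t : R) : 0 <= t -> t ^+ 2 / 4 <= expR t.
Proof.
move=> t0; have -> : expR t = expR (t / 2) ^+ 2.
  by rewrite -expRM_natl; congr expR; field.
have := expR_ge1Dx (t / 2); nra.
Qed.

(** For [t >= 0] the exponent is [l t - a e^t / 2] up to [|b| / 2], and [e^t]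
    beats every linear term: for [a <> 0] the sign of [a] decides, for [a = 0]
    that of [l].  The growth of [exp] enters through [t^2 / 4 <= e^t]. *)
Lemma half_mass_lty a b l :
  (half_mass a b l < +oo)%E <-> 0 < a \/ (a = 0 /\ l < 0).
Proof.
have bnd t : 0 <= t -> - `|b| <= b * expR (- t) <= `|b|.
  move=> t0; rewrite -ler_norml normrM (gtr0_norm (expR_gt0 _)) ler_piMr//.
  by rewrite expR_le1 oppr_le0.
split; last first.
- move=> [a0|[-> l0]].
    apply: (@half_mass_bounded_lty _ _ _ 1 (2 * (l + 1) ^+ 2 / a + `|b| / 2)) => // t t0.
    have /andP[b1 b2] := bnd t t0; have et := expR_ge_sqr t0.
    have h : a * (t ^+ 2 / 4) <= a * expR t by rewrite ler_pM2l.
    suff : (l + 1) * t - a * (t ^+ 2 / 4) / 2 <= 2 * (l + 1) ^+ 2 / a by lra.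
    rewrite ler_pdivlMr//.
    (* complete the square in [t] *)
    have := sqr_ge0 (a * t - 4 * (l + 1)); nra.
  apply: (@half_mass_bounded_lty _ _ _ (- l) (`|b| / 2)); first by rewrite oppr_gt0.
  by move=> t t0; have /andP[b1 b2] := bnd t t0; lra.
- have [a0 _|a0|<-] := ltgtP 0 a; first by left.
    suff -> : half_mass a b l = +oo%E by [].
    (* beyond [M] the term [- a t^2 / 8] exceeds [|l| t] *)
    pose M := 8 * `|l| / - a.
    have M0 : 0 <= M by rewrite divr_ge0// ?mulr_ge0// oppr_ge0 ltW.
    apply: (@half_mass_eqy _ _ _ M (- `|b| / 2) M0) => t Mt.
    have t0 : 0 <= t := le_trans M0 Mt.
    have /andP[b1 b2] := bnd t t0; have et := expR_ge_sqr t0.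
    have h : - a * (t ^+ 2 / 4) <= - a * expR t by rewrite ler_pM2l// oppr_gt0.
    have h2 : 8 * `|l| <= t * - a by rewrite -ler_pdivrMr ?oppr_gt0.
    have h3 : - (`|l| * t) <= l * t by have := ler_norm (- l); rewrite normrN; nra.
    suff : `|l| * t <= - a * (t ^+ 2 / 4) / 2 by lra.
    nra.
  have [l0 _|l0] := ltP l 0; first by right; split.
  suff -> : half_mass 0 b l = +oo%E by [].
  apply: (@half_mass_eqy _ _ _ 0 (- `|b| / 2)) => // t t0.
  have /andP[b1 b2] := bnd t t0.
  have : 0 <= l * t by rewrite mulr_ge0.
  by lra.
Qed.

Lemma log_mass_gt0 a b l : (0 < log_mass a b l)%E.
Proof. by rewrite log_mass_split adde_gt0 ?half_mass_gt0. Qed.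

(** The two half-lines require [a > 0 \/ (a = 0 /\ l < 0)] and
    [b > 0 \/ (b = 0 /\ l > 0)]; of the four combinations, the one with
    [a = b = 0] is contradictory and the others are the three cases. *)
Lemma log_mass_lty a b l : (log_mass a b l < +oo)%E <-> gig_parameter a b l.
Proof.
have h0 a' b' l' : (0 <= half_mass a' b' l')%E by exact/ltW/half_mass_gt0.
rewrite log_mass_split; split=> [fin|par].
  have /half_mass_lty A : (half_mass a b l < +oo)%E.
    by apply: le_lt_trans fin; rewrite leeDl.
  have /half_mass_lty B : (half_mass b a (- l) < +oo)%E.
    by apply: le_lt_trans fin; rewrite leeDr.
  move: A B; rewrite oppr_lt0 => -[a0|[a0 l0]] [b0|[b0 l1]].
  - exact: Or31.
  - exact: Or32.
  - exact: Or33.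
  - by have := lt_trans l0 l1; rewrite ltxx.
suff [A B] : (half_mass a b l < +oo)%E /\ (half_mass b a (- l) < +oo)%E.
  exact: lte_add_pinfty.
rewrite !half_mass_lty oppr_lt0.
by case: par => [[]|[]|[]]; split; tauto.
Qed.

Lemma log_mass_fineK a b l :
  gig_parameter a b l -> (fine (log_mass a b l))%:E = log_mass a b l.
Proof.
move=> /log_mass_lty fin; rewrite fineK// ge0_fin_numE//.
exact/ltW/log_mass_gt0.
Qed.

End logmass.

(** * Normalizing constants *)

Section constants.
Context {R : realType}.
Local Notation mu := (@lebesgue_measure R).
Implicit Types a b l z : R.

(** The unnormalized density with respect to [dx]. *)
Definition gig_kernel a b l (x : R) : R :=
  x `^ (l - 1) * expR (- (a * x + b / x) / 2).

Lemma gig_kernel_ge0 a b l x : 0 <= gig_kernel a b l x.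
Proof. by rewrite mulr_ge0 ?powR_ge0 ?expR_ge0. Qed.

Lemma gig_kernel_expR a b l t :
  gig_kernel a b l (expR t) * expR t = log_density a b l t.
Proof.
rewrite /gig_kernel /powR expR_eq0 expRK -!expRD -expRN /log_density.
by congr expR; ring.
Qed.

Lemma continuous_gig_kernel a b l :
  {in `]0, +oo[, continuous (gig_kernel a b l)}.
Proof.
move=> x xI; have x0 : 0 < x by move: xI; rewrite in_itv/= andbT.
apply: cvgM.
  have /derivable1_diffP/differentiable_continuous :
      derivable (fun y : R => y `^ (l - 1) : R) (x : R) 1.
    exact: derivable_powR.
  exact.
apply: continuous_comp; last exact: continuous_expR.
apply: cvgM; last exact: cvg_cst.
apply: cvgN; apply: cvgD; apply: cvgM; try exact: cvg_cst; first exact: cvg_id.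
by apply: inv_continuous; rewrite gt_eqF.
Qed.

Lemma integral_gig_kernel a b l :
  (\int[mu]_(x in `]0%R, +oo[) (gig_kernel a b l x)%:E = log_mass a b l)%E.
Proof.
rewrite ge0_integral_expR_subst.
- by under eq_integral do rewrite gig_kernel_expR.
- exact: continuous_gig_kernel.
- by move=> x _; exact: gig_kernel_ge0.
Qed.

Lemma GammaE l : Gamma l = fine (log_mass 2 0 l).
Proof.
rewrite -integral_gig_kernel /Gamma /Rintegral; congr fine.
apply: eq_integral => x _; rewrite /gig_kernel mul0r addr0.
by congr (_ * expR _)%:E; field.
Qed.

(** Folding the line at [0] adds [e^(l t)] and [e^(- l t)], that is
    [2 cosh (l t)], against the even factor [exp (- z cosh t)]. *)
Lemma log_mass_besselK l z : 0 < z ->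
  log_mass z z l = (2 * besselK l z)%:E.
Proof.
move=> z0; have par : gig_parameter z z l by apply: Or31.
rewrite -(log_mass_fineK par) log_mass_split; congr EFin.
rewrite /besselK /Rintegral.
set c := fun t => expR (- (z * ((expR t + expR (- t)) / 2))) *
                  ((expR (l * t) + expR (- (l * t))) / 2).
have cE t : log_density z z l t + log_density z z (- l) t = 2 * c t.
  rewrite /log_density /c [RHS]mulrCA [2 * _]mulrC divfK// mulrDr -!expRD.
  by congr (expR _ + expR _); ring.
have mc : measurable_fun (`[0, +oo[%classic : set R) (fun t => (c t)%:E).
  have -> : c = (fun t => 2^-1 * (log_density z z l t + log_density z z (- l) t)).
    by apply/funext => t; rewrite cE mulKf.
  apply/measurable_EFinP; apply: measurable_funM => //.
  by apply: measurable_funD; apply/measurable_EFinP; exact: measurable_log_density.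
have c0 t : 0 <= c t.
  by rewrite -(@pmulr_rge0 _ 2)// -cE addr_ge0// log_density_ge0.
have -> : (half_mass z z l + half_mass z z (- l) =
    2%:E * \int[mu]_(t in `[0%R, +oo[) (c t)%:E)%E.
  rewrite -ge0_integralZl_EFin//; last by move=> t _; rewrite lee_fin.
  rewrite -ge0_integralD//; first last.
  - exact: measurable_log_density.
  - by move=> t _; rewrite lee_fin log_density_ge0.
  - exact: measurable_log_density.
  - by move=> t _; rewrite lee_fin log_density_ge0.
  by apply: eq_integral => t _; rewrite -EFinD cE.
case: (integral _ _ _) => [y| |] /=; rewrite ?mulr0//.
- by rewrite gt0_muley// lte_fin.
- by rewrite gt0_muleNy// lte_fin.
Qed.

(** A translation by [c] normalizes the parameters: [e^c = 2 / a] turns [(a, 0)]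
    into [(2, 0)], and [e^c = sqrt (b / a)] makes both parameters equal to
    [sqrt (a b)].  The case [a = 0] is the case [b = 0] reflected. *)
Lemma gig_constant_mass a b l : gig_parameter a b l ->
  ((gig_constant a b l)%:E * log_mass a b l = 1)%E.
Proof.
have gen c l' : 0 < c -> 0 < l' ->
    log_mass c 0 l' = ((c / 2) `^ (- l') * Gamma l')%:E /\ 0 < Gamma l'.
  move=> c0 l0; have par : gig_parameter 2 0 l' by apply: Or32.
  have G0 : 0 < Gamma l'.
    by rewrite -lte_fin GammaE log_mass_fineK// log_mass_gt0.
  split=> //; rewrite EFinM GammaE log_mass_fineK//.
  rewrite (log_mass_translate _ _ _ (- ln (c / 2))) mul0r.
  rewrite [X in log_mass X](_ : _ = 2); last first.
    by rewrite expRN lnK ?posrE ?divr_gt0//; field; rewrite gt_eqF.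
  by rewrite /powR gt_eqF ?divr_gt0// mulrN mulNr.
have pw c l' : 0 < c -> c `^ l' * c `^ (- l') = 1.
  by move=> c0; rewrite powRN divff// gt_eqF// powR_gt0.
rewrite /gig_constant; case=> [[a0 b0]|[a0 -> l0]|[-> b0 l0]].
- rewrite (gt_eqF b0) (gt_eqF a0).
  rewrite (log_mass_translate _ _ _ (ln (b / a) / 2)).
  have e1 : expR (ln (b / a) / 2) = Num.sqrt (b / a).
    by rewrite -powR12_sqrt ?divr_ge0 ?ltW// /powR gt_eqF ?divr_gt0// mulrC.
  have sa := sqr_sqrtr (ltW a0); have sb := sqr_sqrtr (ltW b0).
  have sa0 : 0 < Num.sqrt a by rewrite sqrtr_gt0.
  have sb0 : 0 < Num.sqrt b by rewrite sqrtr_gt0.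
  have e2 : a * expR (ln (b / a) / 2) = Num.sqrt (a * b).
    rewrite e1 !sqrtrM ?ltW// sqrtrV ?ltW// -{1}sa.
    by field; rewrite gt_eqF.
  have e3 : b * expR (- (ln (b / a) / 2)) = Num.sqrt (a * b).
    rewrite expRN e1 !sqrtrM ?ltW// sqrtrV ?ltW// -{1}sb.
    by field; rewrite !gt_eqF.
  have z0 : 0 < Num.sqrt (a * b) by rewrite sqrtr_gt0 mulr_gt0.
  rewrite e2 e3 log_mass_besselK// -!EFinM; congr EFin.
  have K0 : 0 < 2 * besselK l (Num.sqrt (a * b)).
    by rewrite -lte_fin -log_mass_besselK// log_mass_gt0.
  rewrite mulrCA divfK ?gt_eqF//.
  have -> : l * (ln (b / a) / 2) = - (l / 2) * ln (a / b).
    by rewrite !ln_div ?posrE//; field.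
  have <- : (a / b) `^ (- (l / 2)) = expR (- (l / 2) * ln (a / b)).
    by rewrite /powR gt_eqF ?divr_gt0.
  by rewrite mulrC pw ?divr_gt0.
- rewrite eqxx; have [-> G0] := gen _ _ a0 l0; rewrite -EFinM; congr EFin.
  rewrite mulrA -[X in X * _]mulrA pw ?divr_gt0//.
  by rewrite mulr1 mulVf// gt_eqF.
- rewrite (gt_eqF b0) eqxx.
  have l1 : 0 < - l by rewrite oppr_gt0.
  have -> : log_mass 0 b l = log_mass b 0 (- l).
    by rewrite !log_mass_split opprK addeC.
  have [-> G0] := gen _ _ b0 l1; rewrite -EFinM; congr EFin.
  rewrite mulrA -[X in X * _]mulrA pw ?divr_gt0//.
  by rewrite mulr1 mulVf// gt_eqF.
Qed.

End constants.

(** * Integration on the positive reals *)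

Section density.
Context d (T : measurableType d) {R : realType}.
Variables (m nu : {measure set T -> \bar R}) (h : T -> R).
Hypothesis h0 : forall x, 0 <= h x.
Hypothesis mh : measurable_fun setT h.
Hypothesis nuE : forall A, measurable A -> nu A = (\int[m]_(x in A) (h x)%:E)%E.

Import HBNNSimple.
Local Open Scope ereal_scope.

(** [nu = h m] integrates [f] as [m] integrates [f h]: true for indicators by
    hypothesis, for simple functions by linearity, and in general by monotone
    convergence along simple approximations.  The measure [nu]
    may have infinite mass, as [dx / x] has. *)
Lemma ge0_integral_density (D : set T) (f : T -> \bar R) :
  measurable D -> measurable_fun D f -> (forall x, D x -> 0 <= f x) ->
  \int[nu]_(x in D) f x = \int[m]_(x in D) (f x * (h x)%:E).
Proof.
move=> mD mf f0; pose s := nnsfun_approx mD mf.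
have sf x : D x -> (EFin \o s n) x @[n --> \oo] --> f x.
  by move=> Dx; exact: cvg_nnsfun_approx.
have nds x a b : (a <= b)%N -> (s a x <= s b x)%R.
  by move=> ab; exact/lefP/nd_nnsfun_approx.
have mhD : measurable_fun D (fun x => (h x)%:E).
  exact/measurable_EFinP/measurable_funTS.
have sE n : \int[nu]_(x in D) (s n x)%:E = \int[m]_(x in D) ((s n x)%:E * (h x)%:E).
  transitivity (\int[nu]_(x in D)
     (\sum_(y \in range (s n)) (y * \1_(s n @^-1` [set y]) x)%:E)).
    by apply: eq_integral => t tD; rewrite /= fimfunE -fsumEFin.
  transitivity (\int[m]_(x in D)
     (\sum_(y \in range (s n)) (y * \1_(s n @^-1` [set y]) x)%:E * (h x)%:E)); last first.
    apply: eq_integral => t tD; rewrite /= [in RHS]fimfunE -fsumEFin//.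
    by rewrite ge0_mule_fsuml// => r; exact: nnfun_muleindic_ge0.
  rewrite !ge0_integral_fsum//; first last.
  - by move=> r x Dx; exact: nnfun_muleindic_ge0.
  - by move=> r; apply/measurable_EFinP/measurable_funTS; exact: measurable_funM.
  - move=> r x Dx; rewrite mule_ge0 ?lee_fin//; exact: nnfun_muleindic_ge0.
  - move=> r; apply: emeasurable_funM => //.
    by apply/measurable_EFinP/measurable_funTS; exact: measurable_funM.
  apply: eq_fsbigr => r; rewrite inE => -[z _ szr].
  have r0 : (0 <= r)%R by rewrite -szr.
  have ms : measurable (s n @^-1` [set r]) by [].
  under eq_integral do rewrite EFinM.
  under [RHS]eq_integral do rewrite EFinM -muleA.
  rewrite !ge0_integralZl_EFin//.
  - congr (_ * _); rewrite integral_indic// nuE; last exact: measurableI.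
    under [RHS]eq_integral do rewrite muleC.
    rewrite setIC integral_mkcondr; apply: eq_integral => x _.
    by rewrite epatch_indic.
  - by move=> x _; rewrite mule_ge0 ?lee_fin.
  - by apply: emeasurable_funM => //; exact/measurable_EFinP.
  - exact/measurable_EFinP.
transitivity (limn (fun n => \int[nu]_(x in D) (s n x)%:E)).
  rewrite -monotone_convergence//.
  - by apply: eq_integral => x /[!inE] Dx; apply/esym/cvg_lim => //; exact: sf.
  - by move=> n; exact/measurable_EFinP/measurable_funTS.
  - by move=> n x _; rewrite lee_fin.
  - by move=> x _ a b ab; rewrite lee_fin nds.
under eq_fun do rewrite sE.
rewrite -monotone_convergence//.
- apply: eq_integral => x /[!inE] Dx; apply/cvg_lim => //.
  by apply: cvgeZr => //; exact: sf.
- move=> n; apply: emeasurable_funM => //.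
  exact/measurable_EFinP/measurable_funTS.
- by move=> n x _; rewrite mule_ge0 ?lee_fin.
- by move=> x _ a b ab; rewrite lee_wpmul2r ?lee_fin ?nds.
Qed.
End density.

Section rpos.
Context {R : realType}.
Local Notation mu := (@lebesgue_measure R).

(** The inclusion of the positive reals pushes their Lebesgue measure forward to
    the restriction of Lebesgue measure to the open half-line. *)
Lemma integral_Rpos_lebesgue (g : R -> R) :
  measurable_fun (`]0, +oo[%classic : set R) g ->
  {in `]0, +oo[, forall x, 0 <= g x} ->
  (\int[@Rpos_lebesgue R]_x (g x)%:E =
   \int[mu]_(x in `]0%R, +oo[) (g x)%:E)%E.
Proof.
move=> mg g0.
have posE : @rpos_val R @^-1` `]0, +oo[%classic = setT.
  by apply/seteqP; split=> // x _; rewrite /= in_itv/= andbT rpos_gt0.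
transitivity (\int[pushforward (@Rpos_lebesgue R)
    (@rpos_val R : Rpos R -> measurableTypeR R)]_(x in `]0%R, +oo[)
    (g x)%:E)%E.
  rewrite ge0_integral_pushforward//.
  - by rewrite posE.
  - exact: measurable_rpos_val.
  - exact/measurable_EFinP.
  - by move=> x; rewrite inE/= => /g0; rewrite lee_fin.
apply: eq_measure_integral => [|mv A mA A0].
  exact: measurable_rpos_val.
rewrite /pushforward /Rpos_lebesgue; congr (mu _).
apply/seteqP; split=> [_ [x Ax <-]//|x Ax].
have x0 : 0 < x by have := A0 _ Ax; rewrite /= in_itv/= andbT.
by exists (MkRpos x0).
Qed.

Lemma integral_Rpos_haar (A : set (Rpos R)) (f : Rpos R -> R) :
  measurable A -> measurable_fun A f -> (forall x, 0 <= f x) ->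
  (\int[Rpos_haar]_(x in A) (f x)%:E =
   \int[Rpos_lebesgue]_(x in A) (f x / (x : R))%:E)%E.
Proof.
move=> mA mf f0.
rewrite (@ge0_integral_density _ _ _ (@Rpos_lebesgue R) _ (fun x => (x : R)^-1))//.
- by move=> x; rewrite invr_ge0 ltW// rpos_gt0.
- have -> : (fun x : Rpos R => (x : R)^-1)%R =
    (fun y : R => y `^ (-1))%R \o @rpos_val R.
    by apply/funext => x /=; rewrite powR_inv1// ltW// rpos_gt0.
  apply: measurableT_comp; last exact: measurable_rpos_val.
  exact: measurable_powR.
- exact/measurable_EFinP.
- by move=> x _; rewrite lee_fin.
Qed.

End rpos.

(** * The representation *)

Section rep.
Context {R : realType}.
Implicit Types r s : R.

Lemma gig_rep_cvec2 (g : Rpos R) r s :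
  gig_rep g *m cvec2 r s = cvec2 ((g : R) * r) ((g : R)^-1 * s).
Proof.
apply/matrixP => i j; rewrite !mxE !big_ord_recl big_ord0 !mxE/= addr0.
by case: i => -[|[|//]] /= ?; rewrite ?mul0r ?addr0 ?add0r.
Qed.

Lemma cvec2E r s : cvec2 r s = r *: delta_mx 0 0 + s *: delta_mx 1 0.
Proof.
apply/matrixP => i j; rewrite !mxE ord1.
by case: i => -[|[|//]] /= ?; rewrite ?(mulr1, mulr0, addr0, add0r).
Qed.

Lemma cvec2_eta (w : 'cV[R]_2) : w = cvec2 (w 0 0) (w 1 0).
Proof.
apply/matrixP => i j; rewrite !mxE ord1.
by case: i => -[|[|//]] /= ?; congr (w _ _); exact: val_inj.
Qed.

Lemma continuous_gig_rep : continuous (@gig_rep R).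
Proof.
have -> : @gig_rep R = fun g => (g : R) *: delta_mx 0 0 + (g : R)^-1 *: delta_mx 1 1.
  apply/funext => g; apply/matrixP => i j; rewrite !mxE.
  by case: i => -[|[|//]] /= ?; case: j => -[|[|//]] /= ?;
    rewrite ?(mulr1, mulr0, addr0, add0r).
have cZ (f : Rpos R -> R) (M : 'M[R]_2) :
    continuous f -> continuous (fun g => f g *: M).
  by move=> cf g; apply: (@cvgZ R 'M[R]_2 _ _ _ f (cst M) _ _ (cf g) (cvg_cst _)).
have cV : continuous (fun g : Rpos R => (g : R)^-1).
  move=> g; apply: (@continuous_comp _ _ _ (@rpos_val R) GRing.inv).
    exact: rpos_val_continuous.
  by apply: inv_continuous; rewrite gt_eqF// rpos_gt0.
move=> g.
exact: (cvgD (cZ _ (delta_mx 0 0) (@rpos_val_continuous R) g)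
             (cZ _ (delta_mx 1 1) cV g)).
Qed.

Lemma gig_rep_representation : representation (@gig_rep R).
Proof.
split; last exact: continuous_gig_rep.
- apply/matrixP => i j; rewrite !mxE invr1.
  by case: eqP => //; case: ifP.
- move=> g h; apply/matrixP => i j; rewrite !mxE !big_ord_recl big_ord0 !mxE/=.
  by case: i => -[|[|//]] /= ?; case: j => -[|[|//]] /= ?;
    rewrite ?(mul0r, mulr0, addr0, add0r)// invfM.
Qed.

(** The vectors [g v] for [g = 1] and [g = 2] already span the plane. *)
Lemma gig_rep_cyclic_pair r s : r != 0 -> s != 0 ->
  cyclic_pair gig_rep (cvec2 r s).
Proof.
move=> r0 s0; split; first exact: gig_rep_representation.
move=> w; rewrite (cvec2_eta w); set u := w 0 0; set v := w 1 0.
(* [c1] is the coefficient of the second vector [(2 r, s / 2)]; it solves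
   the 2 x 2 linear system [c0 + 2 c1 = u / r], [c0 + c1 / 2 = v / s] *)
pose c1 : R := 2 / 3 * (u / r - v / s).
exists 2, (fun i => if i == 0 then u / r - 2 * c1 else c1),
  (fun i => if i == 0 then 1%g else MkRpos (@ltr0Sn R 1)).
rewrite !big_ord_recl big_ord0 addr0 /= !gig_rep_cvec2 !cvec2E/= !scalerDr.
rewrite !scalerA addrACA -!scalerDl invr1.
by congr (_ *: _ + _ *: _); rewrite /c1; field; rewrite ?r0 ?s0.
Qed.

(** The isomorphism is the diagonal matrix with entries [r' / r] and [s' / s]. *)
Lemma gig_rep_equivalent_pairs r s r' s' :
  r != 0 -> s != 0 -> r' != 0 -> s' != 0 ->
  equivalent_pairs gig_rep (cvec2 r s) gig_rep (cvec2 r' s').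
Proof.
move=> r0 s0 r0' s0'.
pose D (x y : R) : 'M[R]_2 :=
  \matrix_(i, j) if i == j then (if i == 0 then x else y) else 0.
have DE x y u v : D x y *m cvec2 u v = cvec2 (x * u) (y * v).
  apply/matrixP => i j; rewrite !mxE !big_ord_recl big_ord0 !mxE/= addr0.
  by case: i => -[|[|//]] /= ?; rewrite ?mul0r ?addr0 ?add0r.
exists (mulmx (D (r' / r) (s' / s))); split.
- exists (mulmx (D (r / r') (s / s'))) => w; rewrite /= (cvec2_eta w) !DE;
    by congr (cvec2 _ _); field; rewrite ?r0 ?s0 ?r0' ?s0'.
- move=> g w; rewrite /= (cvec2_eta w) gig_rep_cvec2 !DE.
  by congr (cvec2 _ _); rewrite mulrCA.
- by rewrite /= DE !divfK.
Qed.

End rep.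

(** * Characters of the positive reals *)

Section characters.
Context {R : realType}.

(** Subtracting the linear map [t -> t phi(1)] leaves an additive [k] that vanishes
    at [1], hence is periodic of period [1]; being continuous it is bounded, and
    a bounded additive map is zero because [k (n t) = n k(t)]. *)
Lemma continuous_additive_linear (phi : {additive R -> R}) :
  continuous phi -> forall t, phi t = t * phi 1.
Proof.
move=> cphi.
pose k t := phi t - t * phi 1.
have kD : zmod_morphism k.
  by move=> x y; rewrite /k raddfB mulrBl; ring.
pose K : {additive R -> R} := HB.pack k (GRing.isZmodMorphism.Build _ _ k kD).
have K1 : K 1 = 0 by rewrite /= /k mul1r subrr.
have ck : continuous k.
  move=> t; apply: cvgB; first exact: cphi.
  by apply: cvgM; [exact: cvg_id|exact: cvg_cst].
have [c _ kc] : exists2 c, c \in `[0, 1]%R &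
    forall t, t \in `[0, 1]%R -> `|k t| <= `|k c|.
  apply: (@EVT_max _ (fun t => `|k t|)) => //.
  apply: continuous_subspaceT => t.
  by apply: continuous_comp; [exact: ck|exact: norm_continuous].
have kb t : `|k t| <= `|k c|.
  have -> : k t = k (t - (Num.floor t)%:~R).
    by rewrite -[k]/(K : R -> R) raddfB -[_%:~R]/(1 *~ _) raddfMz K1 mul0rz subr0.
  apply: kc; rewrite in_itv/= subr_ge0 ge_floor/= lerBlDr addrC.
  by apply: ltW; have := lt_succ_floor t; rewrite intrD.
have k0 t : k t = 0.
  apply/eqP; rewrite -normr_le0; apply/ler_addgt0Pl => e e0; rewrite addr0.
  pose n := (Num.truncn (`|k c| / e)).+1.
  have h : `|k c| / e < n%:R by exact: truncnS_gt.
  have n0 : 0 < n%:R :> R by rewrite ltr0n.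
  rewrite -(@ler_pM2l _ n%:R)//.
  have -> : n%:R * `|k t| = `|k (t *+ n)|.
    by rewrite -[k]/(K : R -> R) raddfMn normrMn mulr_natl.
  apply: (le_trans (kb _)); apply: ltW.
  by rewrite -ltr_pdivrMr.
by move=> t; apply/eqP; rewrite -subr_eq0; apply/eqP; exact: k0.
Qed.

Definition rpos_exp (t : R) : Rpos R := MkRpos (expR_gt0 t).

Lemma continuous_rpos_exp : continuous rpos_exp.
Proof.
apply: (@continuous_comp_initial _ _ _ (@rpos_val R)).
exact: continuous_expR.
Qed.

Lemma Omega0_powR (chi : Rpos R -> Rpos R) :
  Omega0 [set 1%g] chi -> exists l : R, forall x, chi x = (x : R) `^ l :> R.
Proof.
move=> [cchi chiM _].
pose phi t : R := ln (chi (rpos_exp t) : R).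
have phiD : {morph phi : x y / x + y >-> x + y}.
  move=> x y; rewrite /phi -lnM ?posrE ?rpos_gt0//.
  have -> : rpos_exp (x + y) = (rpos_exp x * rpos_exp y)%g.
    by apply: val_inj; rewrite /= expRD.
  by rewrite chiM.
have phi0 : phi 0 = 0.
  by apply/eqP; rewrite -[_ == _](inj_eq (addrI (phi 0))) -phiD !addr0.
have phiB : zmod_morphism phi.
  by move=> x y; apply/eqP; rewrite eq_sym subr_eq -phiD subrK.
pose Phi : {additive R -> R} :=
  HB.pack phi (GRing.isZmodMorphism.Build _ _ phi phiB).
have cphi : continuous phi.
  move=> t.
  apply: (@continuous_comp _ _ _ (fun t => rpos_val (chi (rpos_exp t))) (@ln R)).
    apply: (@continuous_comp _ _ _ (chi \o rpos_exp) (@rpos_val R)).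
      apply: continuous_comp; [exact: continuous_rpos_exp|exact: cchi].
    exact: rpos_val_continuous.
  by apply: continuous_ln; exact: rpos_gt0.
exists (phi 1) => x.
have x0 := rpos_gt0 x.
have -> : x = rpos_exp (ln (x : R)).
  by apply: val_inj; rewrite /= lnK.
have := @continuous_additive_linear Phi cphi (ln (x : R)); rewrite /= {1}/phi => e.
rewrite -[LHS]lnK ?posrE ?rpos_gt0// e /powR.
by rewrite /= gt_eqF ?expR_gt0// expRK mulrC.
Qed.

Definition rpos_pow (l : R) (x : Rpos R) : Rpos R :=
  MkRpos (powR_gt0 l (rpos_gt0 x)).

Lemma rpos_pow_Omega0 (l : R) : Omega0 [set 1%g] (rpos_pow l).
Proof.
split=> [|x y|_ ->].
- apply: (@continuous_comp_initial _ _ _ (@rpos_val R)) => x.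
  apply: (@continuous_comp _ _ _ (@rpos_val R) (fun y => y `^ l)).
    exact: rpos_val_continuous.
  have /derivable1_diffP/differentiable_continuous :
      derivable (fun y : R => y `^ l : R) (x : R) 1.
    by apply: derivable_powR; rewrite in_itv/= andbT rpos_gt0.
  exact.
- by apply: val_inj; rewrite /= powRM// ltW// rpos_gt0.
- by apply: val_inj; rewrite /= powR1.
Qed.
End characters.

(** * The generated family *)

Section family.
Context {R : realType}.
Implicit Types a b l : R.

(** The unnormalized density with respect to [dx / x]. *)
Definition gig_weight a b l (x : Rpos R) : R :=
  let t : R := x in t `^ l * expR (- (a * t + b / t) / 2).

Lemma gig_weight_ge0 a b l x : 0 <= gig_weight a b l x.
Proof. by rewrite mulr_ge0 ?powR_ge0 ?expR_ge0. Qed.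

Lemma gig_weight_div a b l x :
  gig_weight a b l x / (x : R) = gig_kernel a b l x.
Proof.
have x0 := rpos_gt0 x.
rewrite /gig_weight /gig_kernel mulrAC powRB; last by rewrite (gt_eqF x0) implybT.
by rewrite powRr1// ltW.
Qed.

Lemma gig_density_kernel a b l x :
  gig_density a b l x = gig_constant a b l * gig_kernel a b l x.
Proof. by rewrite /gig_density /gig_kernel mulrA. Qed.

Lemma measurable_gig_kernel a b l :
  measurable_fun (`]0, +oo[%classic : set R) (gig_kernel a b l).
Proof.
apply: open_continuous_measurable_fun => // x.
by rewrite inE/=; exact: continuous_gig_kernel.
Qed.

Lemma measurable_gig_kernel_Rpos a b l (A : set (Rpos R)) :
  measurable_fun A (fun x : Rpos R => gig_kernel a b l x).
Proof.
apply: measurable_funTS.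
apply: (measurable_comp (measurable_itv `]0, +oo[) _
  (measurable_gig_kernel a b l) (@measurable_rpos_val R)).
by move=> _ [x _ <-]; rewrite /= in_itv/= andbT rpos_gt0.
Qed.

Lemma measurable_gig_weight a b l (A : set (Rpos R)) :
  measurable_fun A (gig_weight a b l).
Proof.
have -> : gig_weight a b l = fun x : Rpos R => gig_kernel a b (l + 1) x.
  by apply/funext => x; rewrite /gig_kernel addrK.
exact: measurable_gig_kernel_Rpos.
Qed.

Lemma integral_haar_gig_weight a b l (A : set (Rpos R)) : measurable A ->
  (\int[Rpos_haar]_(x in A) (gig_weight a b l x)%:E =
   \int[Rpos_lebesgue]_(x in A) (gig_kernel a b l x)%:E)%E.
Proof.
move=> mA; rewrite integral_Rpos_haar//; last exact: gig_weight_ge0.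
  by apply: eq_integral => x _; rewrite gig_weight_div.
exact: measurable_gig_weight.
Qed.

Lemma integral_lebesgue_gig_kernel a b l :
  (\int[@Rpos_lebesgue R]_x (gig_kernel a b l x)%:E = log_mass a b l)%E.
Proof.
rewrite integral_Rpos_lebesgue ?integral_gig_kernel//.
- exact: measurable_gig_kernel.
- by move=> x _; exact: gig_kernel_ge0.
Qed.

(** The generated family divides by the mass, the inverse Gaussian family
    multiplies by the explicit constant. *)
Lemma gig_constantE a b l : gig_parameter a b l ->
  (gig_constant a b l)%:E = ((log_mass a b l)^-1)%E.
Proof.
move=> par; have m0 := log_mass_gt0 a b l; have := gig_constant_mass par.
rewrite -(log_mass_fineK par) in m0 *.
set m := fine _ in m0 *; rewrite lte_fin in m0.
rewrite -EFinM => -[cm]; rewrite inver gt_eqF//; congr EFin.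
by apply: (mulIf (lt0r_neq0 m0)); rewrite cm mulVf ?lt0r_neq0.
Qed.

Lemma gig_constant_ge0 a b l : gig_parameter a b l -> 0 <= gig_constant a b l.
Proof.
move=> par; have m0 := log_mass_gt0 a b l; have := gig_constantE par.
rewrite -(log_mass_fineK par) in m0 *.
rewrite lte_fin in m0; rewrite inver gt_eqF// => -[->].
by rewrite invr_ge0 ltW.
Qed.

Lemma integral_gig_density a b l (A : set (Rpos R)) :
  gig_parameter a b l -> measurable A ->
  (\int[Rpos_lebesgue]_(x in A) (gig_density a b l x)%:E =
   \int[Rpos_haar]_(x in A) (gig_weight a b l x)%:E /
   \int[@Rpos_haar R]_x (gig_weight a b l x)%:E)%E.
Proof.
move=> par mA; rewrite !integral_haar_gig_weight// integral_lebesgue_gig_kernel.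
rewrite -gig_constantE// muleC.
rewrite -ge0_integralZl_EFin//; first last.
- exact: gig_constant_ge0.
- by apply/measurable_EFinP; exact: measurable_gig_kernel_Rpos.
- by move=> x _; rewrite lee_fin gig_kernel_ge0.
by apply: eq_integral => x _; rewrite gig_density_kernel.
Qed.

Lemma integral_gig_density1 a b l : gig_parameter a b l ->
  (\int[@Rpos_lebesgue R]_x (gig_density a b l x)%:E = 1)%E.
Proof.
move=> par; rewrite integral_gig_density// integral_haar_gig_weight//.
by rewrite integral_lebesgue_gig_kernel -gig_constantE// muleC gig_constant_mass.
Qed.

(** For [r] and [s] nonzero, the two coefficients range over the whole plane as
    [xi] does: this is where the parameters [a / 2] and [b / 2] come from. *)
Lemma scalar_gig_rep (xi : {scalar 'cV[R]_2}) (g : Rpos R) (r s : R) :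
  xi (gig_rep g *m cvec2 r s) =
  r * xi (delta_mx 0 0) * (g : R) + s * xi (delta_mx 1 0) / (g : R).
Proof.
rewrite gig_rep_cvec2 cvec2E linearD !linearZ/=.
by congr (_ + _); ring.
Qed.

Lemma scalar_coords (u v : R) : exists xi : {scalar 'cV[R]_2},
  xi (delta_mx 0 0) = u /\ xi (delta_mx 1 0) = v.
Proof.
pose f (w : 'cV[R]_2) : R := u * w 0 0 + v * w 1 0.
have fl : scalar f.
  by move=> k x y; rewrite /f !mxE; ring.
pose xi : {scalar 'cV[R]_2} := HB.pack f (GRing.isLinear.Build _ _ _ _ f fl).
by exists xi; split; rewrite /= /f !mxE/= ?mulr1 ?mulr0 ?addr0 ?add0r.
Qed.

(** The correspondence of parameters is [a = 2 r xi_0], [b = 2 s xi_1], and [l]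
    the exponent of the character; finiteness of the mass translates into
    [gig_parameter]. *)
Lemma generated_family_gig (r s : R) : r != 0 -> s != 0 ->
  generated_family [set 1%g] (fun g : Rpos R => g) Rpos_haar
    gig_rep (cvec2 r s) = gig_family.
Proof.
move=> r0 s0; apply/seteqP; split => P.
- move=> [xi [chi [f [/Omega0_powR[l chiE] fE fin PE]]]].
  pose a := 2 * (r * xi (delta_mx 0 0)); pose b := 2 * (s * xi (delta_mx 1 0)).
  have fw : f = gig_weight a b l.
    apply/funext => x; rewrite fE chiE [LHS]mulrC; congr (_ * expR _).
    by rewrite scalar_gig_rep /a /b; field; rewrite gt_eqF// rpos_gt0.
  rewrite {}fw {fE} in fin PE.
  have par : gig_parameter a b l.
    apply/log_mass_lty; rewrite -integral_lebesgue_gig_kernel.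
    by rewrite -integral_haar_gig_weight.
  exists a, b, l; split=> // A mA.
  by rewrite PE// integral_gig_density.
- move=> [a [b [l [par PE]]]].
  have [xi [xi0 xi1]] := scalar_coords (a / 2 / r) (b / 2 / s).
  exists xi, (rpos_pow l), (gig_weight a b l); split.
  + exact: rpos_pow_Omega0.
  + move=> x; rewrite scalar_gig_rep xi0 xi1 [RHS]mulrC; congr (_ * expR _).
    by field; rewrite r0 s0 gt_eqF// rpos_gt0.
  + rewrite integral_haar_gig_weight// integral_lebesgue_gig_kernel.
    exact/log_mass_lty.
  + by move=> A mA; rewrite PE// integral_gig_density.
Qed.

End family.

Theorem proposition2 (R : realType) :
  (forall r s : R, r != 0 -> s != 0 -> cyclic_pair gig_rep (cvec2 r s)) /\
  (forall r s r' s' : R, r != 0 -> s != 0 -> r' != 0 -> s' != 0 ->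
     equivalent_pairs gig_rep (cvec2 r s) gig_rep (cvec2 r' s')) /\
  (forall a b l : R, gig_parameter a b l ->
     (\int[Rpos_lebesgue]_x (gig_density a b l x)%:E = 1)%E) /\
  (forall r s : R, r != 0 -> s != 0 ->
     generated_family [set 1%g] (fun g : Rpos R => g) Rpos_haar
       gig_rep (cvec2 r s) = gig_family).
Proof.
split; first exact: gig_rep_cyclic_pair.
split; first exact: gig_rep_equivalent_pairs.
split; [exact: integral_gig_density1|exact: generated_family_gig].
Qed.
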